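(* Let $n\ge 1$ be an integer, $p,q\in[1,\infty)$ and $\lambda,\sigma,\alpha,\beta\in(0,\infty)$. Assume that $$\left(p>1\text{ and }0<\alpha<\tfrac{n+2}{2p}\right)\ \text{ or }\ \left(p=1\text{ and }0<\alpha\le\tfrac{n+2}{2p}\right),$$ $$\left(q>1\text{ and }0<\beta<\tfrac{n+2}{2q}\right)\ \text{ or }\ \left(q=1\text{ and }0<\beta\le\tfrac{n+2}{2q}\right),$$ and $\sigma<1/\lambda$. Let $$\gamma_1=\frac{(\beta+\alpha\sigma)\lambda}{1-\lambda\sigma},\qquad\gamma_2=\frac{(\alpha+\beta\lambda)\sigma}{1-\lambda\sigma}.$$ Then there exist $N>0$ and solutions $u\in Y^p_\alpha$ and $v\in Y^q_\beta$ of $$0\le(\partial_t-\Delta)^\alpha u\le v^\lambda,\qquad 0\le(\partial_t-\Delta)^\beta v\le u^\sigma\qquad\text{in }\mathbb{R}^n\times\mathbb{R},$$ $$u=v=0\quad\text{in }\mathbb{R}^n\times(-\infty,0),$$ such that for $|x|^2<t$ $$u(x,t)\ge Nt^{\gamma_2/\sigma}\quad\text{and}\quad v(x,t)\ge Nt^{\gamma_1/\lambda}.$$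
   Context: For $p\ge1$, $X^p:=\bigcap_{T\in\mathbb{R}}L^p(\mathbb{R}^n\times(-\infty,T))$, i.e. the set of measurable $f:\mathbb{R}^n\times\mathbb{R}\to\mathbb{R}$ with $\|f\|_{L^p(\mathbb{R}^n\times(-\infty,T))}<\infty$ for all $T\in\mathbb{R}$ (functions equal a.e. are identified). For $\alpha>0$ the fractional heat kernel is $$\Phi_\alpha(x,t):=\frac{t^{\alpha-1}}{\Gamma(\alpha)}\frac{1}{(4\pi t)^{n/2}}e^{-|x|^2/(4t)}\chi_{(0,\infty)}(t),$$ and $$J_\alpha f(x,t):=\iint_{\mathbb{R}^n\times(-\infty,t)}\Phi_\alpha(x-\xi,t-\tau)f(\xi,\tau)\,d\xi\,d\tau .$$ Set $Y^p_\alpha:=J_\alpha(X^p)$. When ($p>1$ and $0<\alpha<\frac{n+2}{2p}$) or ($p=1$ and $0<\alpha\le\frac{n+2}{2p}$), it is known that $J_\alpha f\in L^p_{\rm loc}(\mathbb{R}^n\times\mathbb{R})$ for $f\in X^p$ and that $J_\alpha:X^p\to Y^p_\alpha$ is one-to-one and onto; the fully fractional heat operator $(\partial_t-\Delta)^\alpha:Y^p_\alpha\to X^p$ is defined as the inverse of $J_\alpha:X^p\to Y^p_\alpha$. Likewise $(\partial_t-\Delta)^\beta:Y^q_\beta\to X^q$ is the inverse of $J_\beta:X^q\to Y^q_\beta$. *)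

(* Defs.v *)
From HB Require Import structures.
From mathcomp Require Import all_boot all_order all_algebra.
From mathcomp Require Import all_classical all_reals all_analysis.

Set Implicit Arguments.
Unset Strict Implicit.
Unset Printing Implicit Defensive.

Import Order.TTheory GRing.Theory Num.Theory.
Import numFieldNormedType.Exports.

Local Open Scope classical_set_scope.
Local Open Scope ring_scope.

Notation Rn R n := (n.-tuple (measurableTypeR R)).
Notation spacetime R n := (Rn R n * measurableTypeR R)%type.

(* The instance that the library declares for products of sigma-finite measures
   is shadowed by the one for products of subprobabilities. *)
Lemma product_sigma_finite d1 d2 (T1 : measurableType d1)
    (T2 : measurableType d2) (R : realType)
    (m1 : {sigma_finite_measure set T1 -> \bar R})
    (m2 : {sigma_finite_measure set T2 -> \bar R}) :
  sigma_finite [set: T1 * T2] (m1 \x m2)%E.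
Proof.
have /sigma_finiteP[F [TF ndF Foo]] := sigma_finiteT m1.
have /sigma_finiteP[G [TG ndG Goo]] := sigma_finiteT m2.
exists (fun k => F k `*` G k).
  rewrite -setXTT TF TG predeqE => -[x y]; split.
    move=> [/= [i _ Fix] [k _ Gky]]; exists (maxn i k) => //; split.
    - by move: x Fix; exact/subsetPset/ndF/leq_maxl.
    - by move: y Gky; exact/subsetPset/ndG/leq_maxr.
  by move=> [i _ []/= ? ?]; split; exists i.
move=> k; have [? ?] := Foo k; have [? ?] := Goo k.
split; first exact: measurableX.
by rewrite product_measure1E// lte_mul_pinfty// ge0_fin_numE.
Qed.

Section lebesgue_cons.
Context (R : realType) (n : nat).
Variable mu : {sigma_finite_measure set (Rn R n) -> \bar R}.

Definition tuple_cons (z : measurableTypeR R * Rn R n) : Rn R n.+1 :=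
  [the n.+1.-tuple (measurableTypeR R) of z.1 :: z.2].

Lemma measurable_tuple_cons : measurable_fun [set: _] tuple_cons.
Proof. exact: measurable_cons. Qed.

(* R^{n+1} is identified with R x R^n *)
Definition lebesgue_cons : set (Rn R n.+1) -> \bar R :=
  pushforward (lebesgue_measure \x mu)%E tuple_cons.

Let lebesgue_cons0 : lebesgue_cons set0 = 0%E.
Proof. by rewrite /lebesgue_cons /pushforward preimage_set0 measure0. Qed.

Let lebesgue_cons_ge0 A : (0 <= lebesgue_cons A)%E.
Proof. by rewrite /lebesgue_cons /pushforward measure_ge0. Qed.

Let lebesgue_cons_sigma_additive : semi_sigma_additive lebesgue_cons.
Proof.
rewrite /lebesgue_cons => F mF tF mUF; rewrite /pushforward preimage_bigcup.
apply: measure_semi_sigma_additive.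
- by move=> k; rewrite -[X in measurable X]setTI; exact: measurable_tuple_cons.
- apply/trivIsetP => /= i j _ _ ij; rewrite -preimage_setI.
  by move/trivIsetP : tF => /(_ _ _ _ _ ij) ->//; rewrite preimage_set0.
- rewrite -preimage_bigcup -[X in measurable X]setTI.
  exact: measurable_tuple_cons.
Qed.

HB.instance Definition _ := isMeasure.Build _ _ _ lebesgue_cons
  lebesgue_cons0 lebesgue_cons_ge0 lebesgue_cons_sigma_additive.

Let tuple_uncons (x : Rn R n.+1) : measurableTypeR R * Rn R n :=
  (thead x, [tuple of behead x]).

Let tuple_unconsK : cancel tuple_uncons tuple_cons.
Proof. by move=> x; rewrite [RHS]tuple_eta; exact: val_inj. Qed.

Let tuple_consK : cancel tuple_cons tuple_uncons.
Proof. by move=> [a x]; congr pair; apply: val_inj. Qed.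

Let measurable_tuple_uncons : measurable_fun [set: _] tuple_uncons.
Proof.
apply/measurable_fun_pairP; split; first exact: measurable_tnth.
exact: measurable_behead.
Qed.

Let lebesgue_cons_sigma_finite : sigma_finite [set: _] lebesgue_cons.
Proof.
have [F TF Foo] := product_sigma_finite lebesgue_measure mu.
exists (fun k => tuple_uncons @^-1` F k).
  by rewrite -preimage_bigcup -TF preimage_setT.
move=> k; have [mF Fk] := Foo k; split.
  by rewrite -[X in measurable X]setTI; exact: measurable_tuple_uncons.
rewrite /lebesgue_cons /pushforward -comp_preimage.
by rewrite (_ : _ \o _ = id) ?preimage_id//; apply/funext => z; exact: tuple_consK.
Qed.

HB.instance Definition _ := Measure_isSigmaFinite.Build _ _ _ lebesgue_cons
  lebesgue_cons_sigma_finite.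

End lebesgue_cons.

(* Lebesgue measure on (the Borel sets of) R^n *)
Fixpoint lebesgue_Rn (R : realType) (n : nat) :
    {sigma_finite_measure set (Rn R n) -> \bar R} :=
  match n return {sigma_finite_measure set (Rn R n) -> \bar R} with
  | 0%N => dirac ([tuple] : Rn R 0)
  | m.+1 => lebesgue_cons (lebesgue_Rn R m)
  end.

Lemma lebesgue_Rn_box (R : realType) (n : nat)
    (A : 'I_n -> set (measurableTypeR R)) : (forall i, measurable (A i)) ->
  lebesgue_Rn R n [set x | forall i, A i (tnth x i)] =
  (\prod_(i < n) lebesgue_measure (A i))%E.
Proof.
elim: n A => [|n IH] A mA.
  rewrite big_ord0 /= diracE mem_set// => -[] //.
rewrite big_ord_recl -(IH (fun i => A (lift ord0 i)))//.
rewrite /= /lebesgue_cons /pushforward.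
rewrite -product_measure1E//; last first.
  rewrite (_ : mkset _ =
    \bigcap_(i in [set: 'I_n]) ((@tnth n _ ^~ i) @^-1` A (lift ord0 i))).
    apply: fin_bigcap_measurable => // i _.
    by rewrite -[X in measurable X]setTI; exact: measurable_tnth.
  by apply/seteqP; split => x /= h i; [move=> _|]; apply: h.
congr (product_measure1 _ _ _); apply/seteqP; split => -[a x] /=.
  move=> h; split; first exact: (h ord0).
  by move=> i; have := h (lift ord0 i); rewrite tnthS/=; congr (A _ (tnth _ _)); exact: val_inj.
move=> [ha hx] i; case: (unliftP ord0 i) => [j ->|->//].
by have := hx j; rewrite tnthS/=; congr (A _ (tnth _ _)); exact: val_inj.
Qed.

Section fractional_heat.
Context (R : realType) (n : nat).
Implicit Types (alpha p : R) (x : Rn R n) (z : spacetime R n).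
Implicit Types f u : spacetime R n -> R.

Definition lebesgue_spacetime : set (spacetime R n) -> \bar R :=
  (lebesgue_Rn R n \x lebesgue_measure)%E.
HB.instance Definition _ := Measure.on lebesgue_spacetime.
HB.instance Definition _ := Measure_isSigmaFinite.Build _ _ _
  lebesgue_spacetime (product_sigma_finite (lebesgue_Rn R n) lebesgue_measure).

Definition sqnorm x : R := \sum_(i < n) (tnth x i : R) ^+ 2.

Definition subRn x y : Rn R n := [tuple (tnth x i - tnth y i : R) | i < n].

Definition Gamma alpha : R :=
  (\int[lebesgue_measure]_(s in `]0, +oo[) (s `^ (alpha - 1) * expR (- s)))%R.

Definition Phi alpha x (t : R) : R :=
  t `^ (alpha - 1) / Gamma alpha * ((4 * pi * t) `^ (n%:R / 2))^-1 *
  expR (- (sqnorm x / (4 * t))) * \1_`]0, +oo[ t.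

Definition J alpha f z : \bar R :=
  (\int[lebesgue_spacetime]_(w in [set w : spacetime R n | (w.2 < z.2)%R])
     (Phi alpha (subRn z.1 w.1) (z.2 - w.2) * f w)%:E)%E.

Definition Xspace p : set (spacetime R n -> R) :=
  [set f : spacetime R n -> R | measurable_fun [set: spacetime R n] f /\
    forall T : R, finite_norm lebesgue_spacetime p%:E
      (f \* \1_[set z : spacetime R n | z.2 < T])].

(* The graph of J_alpha : X^p -> Y^p_alpha, elements of both spaces being
   identified when they agree almost everywhere. Read from right to left, it is
   the graph of the inverse map: it says that the class of f is the value of
   (d_t - Delta)^alpha at the class of u. Since u is real-valued, it includes
   that the integral J alpha f converges almost everywhere. *)
Definition is_frac_heat alpha p u f : Prop :=
  Xspace p f /\ {ae lebesgue_spacetime, forall z, (u z)%:E = J alpha f z}.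

Definition Yspace alpha p : set (spacetime R n -> R) :=
  [set u : spacetime R n -> R | exists f, is_frac_heat alpha p u f].

End fractional_heat.

(* Main.v *)
(* The data are taken to be powers of time on the paraboloid |x|^2 < t: put
   f = A t^gamma1 1_{|x|^2 < t} and g = B t^gamma2 1_{|x|^2 < t}, and u = J_alpha f,
   v = J_beta g. Tonelli and the Gaussian integral bound J_alpha f by a multiple of
   the convergent integral of (t - s)^(alpha - 1) over 0 < s < t, so u and v are
   finite everywhere. By parabolic scaling, restricting the
   integral to a box inside the paraboloid gives u >= c A t^(alpha + gamma1) and
   v >= c B t^(beta + gamma2) for |x|^2 < t. Since alpha + gamma1 = gamma2 / sigma
   and beta + gamma2 = gamma1 / lambda, the powers of t match in f <= v^lambda and
   g <= u^sigma, and only A = (c B)^lambda and B = (c A)^sigma remain to be solved,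
   which is possible because lambda sigma < 1. *)
Require Import Defs.
From mathcomp Require Import all_boot all_order all_algebra.
From mathcomp Require Import all_classical all_reals all_analysis.
From mathcomp Require Import measurable_realfun ring lra.

Set Implicit Arguments.
Unset Strict Implicit.
Unset Printing Implicit Defensive.

Import Order.TTheory GRing.Theory Num.Theory.
Import numFieldNormedType.Exports.

Local Open Scope classical_set_scope.
Local Open Scope ring_scope.

(** * Integrability of powers and the Gamma function *)

(** A power is monotone in one direction or the other according to the sign of its exponent, so its
    extremes on an interval sit at the endpoints. With exponent [a - 1], this bound and the next one
    avoid separating [a < 1] from [a >= 1]. *)
Lemma powR_le_max (R : realType) (b u v x : R) : 0 < u -> u <= x <= v ->
  x `^ b <= Num.max (u `^ b) (v `^ b).
Proof.
move=> u0 /andP[ux xv]; have x0 := lt_le_trans u0 ux.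
have v0 := lt_le_trans x0 xv.
rewrite le_max; have [b0|b0] := leP 0 b.
  by rewrite [X in _ || X]ge0_ler_powR ?orbT// nnegrE ltW.
rewrite -(opprK b) (powRN x) (powRN u) lef_pV2 ?posrE ?powR_gt0//.
by rewrite ge0_ler_powR// ?nnegrE ?oppr_ge0 ltW.
Qed.

Lemma powR_ge_min (R : realType) (b u v x : R) : 0 < u -> u <= x <= v ->
  Num.min (u `^ b) (v `^ b) <= x `^ b.
Proof.
move=> u0 /andP[ux xv]; have x0 := lt_le_trans u0 ux.
have v0 := lt_le_trans x0 xv.
rewrite ge_min; have [b0|b0] := leP 0 b.
  by rewrite ge0_ler_powR// ?nnegrE ltW.
rewrite -(opprK b) (powRN x) (powRN v) [X in _ || X]lef_pV2 ?posrE ?powR_gt0//.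
by rewrite [X in _ || X]ge0_ler_powR ?orbT// ?nnegrE ?oppr_ge0 ltW.
Qed.

Lemma dyadic_bracket (R : realType) (r : R) : 0 < r < 1 ->
  exists k, 2^-1 ^+ k.+1 <= r < 2^-1 ^+ k.
Proof.
move=> /andP[r0 r1].
have [k kr] : exists k, 2^-1 ^+ k.+1 <= r.
  have /cvgrPdist_lt/(_ _ r0)[k _ /(_ k.+1 (leqnSn k))] :
      (2^-1 : R) ^+ n @[n --> \oo] --> (0 : R).
    by apply: cvg_expr; rewrite ger0_norm ?invr_ge0// invf_lt1 ?ltr1n.
  by rewrite sub0r normrN ger0_norm ?exprn_ge0 ?invr_ge0// => /ltW; exists k.
have [m mr mmin] := ex_minnP (ex_intro (fun k => 2^-1 ^+ k.+1 <= r) k kr).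
exists m; rewrite mr/=; case: m mr mmin => [|m] mr mmin; first by rewrite expr0.
by rewrite ltNge; apply/negP => /mmin; rewrite ltnn.
Qed.

(* On |s - t| ~ rho 2^-k the integrand is comparable to (rho 2^-k)^(a - 1), so it is
   dominated by a sum of multiples of indicators of balls whose integrals form a
   geometric series. *)
Lemma integral_abs_powR_lty (R : realType) (a t rho : R) (D : set R) :
  0 < a -> 0 < rho -> measurable D -> D `<=` [set s | 0 < `|s - t| < rho] ->
  (\int[lebesgue_measure]_(s in D) (`|s - t| `^ (a - 1))%:E < +oo)%E.
Proof.
move=> a0 rho0 mD Dsub.
pose r k : R := rho * 2^-1 ^+ k.
have r0 k : 0 < r k by rewrite mulr_gt0// exprn_gt0// invr_gt0.
(* On the shell selected by [dyadic_bracket] the ratio of [|s - t|] to [r k] lies in [1/2, 1], so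
   its power [a - 1] is at most [C]. *)
pose C : R := Num.max ((2^-1) `^ (a - 1)) 1.
have C0 : 0 <= C by rewrite le_max ler01 orbT.
pose c k := C * r k `^ (a - 1).
have c0 k : 0 <= c k by rewrite mulr_ge0 ?powR_ge0.
pose f k (s : R) : \bar R := (c k * \1_(ball t (r k)) s)%:E.
have f0 k s : (0 <= f k s)%E by rewrite lee_fin mulr_ge0.
have mf k : measurable_fun D (f k).
  apply/measurable_EFinP; apply: measurable_funM => //.
  by apply: measurable_indic; exact: measurable_ball.
have mpow : measurable_fun D (fun s => (`|s - t| `^ (a - 1))%:E : \bar R).
  apply/measurable_EFinP; apply: (measurableT_comp (measurable_powR _)).
  by apply: measurableT_comp => //; exact: measurable_funB.
have msum : measurable_fun D (fun s => (\sum_(0 <= k <oo) f k s)%E).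
  by apply: ge0_emeasurable_sum.
have dom s : D s -> ((`|s - t| `^ (a - 1))%:E <= \sum_(0 <= k <oo) f k s)%E.
  move=> /Dsub/= /andP[s0 s1].
  have [|k /andP[]] := @dyadic_bracket _ (`|s - t| / rho).
    by rewrite divr_gt0//= ltr_pdivrMr// mul1r.
  rewrite ler_pdivlMr// ltr_pdivrMr// ![_ * rho]mulrC => k1 k2.
  apply: (@le_trans _ _ (f k s)); last first.
    apply: le_trans (nneseries_lim_ge k.+1 _) => //.
    by rewrite big_nat_recr//= leeDr// sume_ge0.
  rewrite /f indicE mem_set/=; last by rewrite /ball/= distrC.
  rewrite lee_fin mulr1; have -> : `|s - t| = (`|s - t| / r k) * r k.
    by rewrite divfK// gt_eqF.
  rewrite powRM ?divr_ge0 ?(ltW (r0 k))// ler_wpM2r ?powR_ge0//.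
  have := @powR_le_max _ (a - 1) 2^-1 1; rewrite powR1; apply.
    by rewrite invr_gt0.
  by rewrite ler_pdivlMr// ler_pdivrMr// mul1r (ltW k2) mulrCA -exprS k1.
have intf k : (\int[lebesgue_measure]_(s in D) f k s <=
    (2 * C * rho `^ a * (2^-1 `^ a) ^+ k)%:E)%E.
  apply: (@le_trans _ _ (\int[lebesgue_measure]_s f k s)%E).
    apply: ge0_subset_integral => //.
    apply/measurable_EFinP; apply: measurable_funM => //.
    by apply: measurable_indic; exact: measurable_ball.
  have -> : (\int[lebesgue_measure]_s f k s =
      (c k)%:E * \int[lebesgue_measure]_s (\1_(ball t (r k)) s)%:E)%E.
    apply: (@integralZl_indic _ _ R lebesgue_measure setT measurableT
      (fun=> ball t (r k))); last exact: measurable_ball.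
    by move=> ck0; have := c0 k; rewrite leNgt ck0.
  rewrite integral_indic//=; last exact: measurable_ball.
  rewrite setIT (lebesgue_measure_ball t (ltW (r0 k))).
  (* The length 2 [r k] of the ball raises the exponent from [a - 1] to [a]; the series is then
     geometric of ratio 2^(-a), which is below 1 because [a > 0]. *)
  have rE : r k `^ (a - 1) * r k = rho `^ a * (2^-1 `^ a) ^+ k.
    rewrite -[X in _ * X = _]powRr1; last exact: ltW.
    rewrite -powRD; last by rewrite (gt_eqF (r0 k)) implybT.
    rewrite subrK /r powRM ?(ltW rho0) ?exprn_ge0 ?invr_ge0//.
    by rewrite -!powR_mulrn ?invr_ge0 ?powR_ge0// -!powRrM [_ * a]mulrC.
  rewrite -EFinM lee_fin -[leRHS]mulrA -rE /c -mulr_natl.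
  by rewrite le_eqVlt; apply/orP; left; apply/eqP; ring.
apply: (@le_lt_trans _ _ (\int[lebesgue_measure]_(s in D) \sum_(0 <= k <oo) f k s)%E).
  exact: ge0_le_integral.
rewrite integral_nneseries//.
apply: (@le_lt_trans _ _
    (\sum_(0 <= k <oo) (2 * C * rho `^ a * (2^-1 `^ a) ^+ k)%:E)%E).
  by apply: lee_nneseries => // k _ _; exact: integral_ge0.
have ha : `|(2^-1 : R) `^ a| < 1.
  rewrite ger0_norm ?powR_ge0//.
  have := @gt0_ltr_powR _ _ a0 2^-1 1; rewrite powR1; apply => //.
  - by rewrite nnegrE invr_ge0.
  - by rewrite nnegrE.
  - by rewrite invf_lt1// ltr1n.
have /cvg_ex[l hl] := @is_cvg_geometric_series R (2 * C * rho `^ a) _ ha.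
suff -> : (\sum_(0 <= k <oo) (2 * C * rho `^ a * (2^-1 `^ a) ^+ k)%:E = l%:E)%E.
  by rewrite ltry.
apply/cvg_lim => //; apply: cvg_EFin; first by near=> n; rewrite sumEFin.
apply: cvg_trans hl; apply: near_eq_cvg; near=> n => /=.
by rewrite sumEFin.
Unshelve. all: by end_near. Qed.

(** Raise y <= exp(y), with y = s / (2b), to the power b. *)
Lemma powR_le_expR (R : realType) (b s : R) : 0 < b -> 0 <= s ->
  s `^ b <= (2 * b) `^ b * expR (s / 2).
Proof.
move=> b0 s0; have b20 : 0 < 2 * b by rewrite mulr_gt0.
have -> : expR (s / 2) = expR (s / (2 * b)) `^ b.
  by rewrite -expRM; congr expR; field; rewrite gt_eqF.
rewrite -powRM ?expR_ge0//; last exact: ltW.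
apply: ge0_ler_powR; rewrite ?nnegrE ?mulr_ge0 ?expR_ge0 ?(ltW b0)//.
rewrite -ler_pdivrMl// mulrC; apply: le_trans (expR_ge1Dx _).
by rewrite lerDr.
Qed.

(** [Gamma] is the [fine] part of an extended integral, which would be 0 if the integral were
    infinite. Positivity therefore requires both a positive lower bound, taken from [1, 2], and
    finiteness, obtained by splitting at 1. *)
Lemma Gamma_gt0 (R : realType) (a : R) : 0 < a -> 0 < Gamma a.
Proof.
move=> a0; rewrite /Gamma /Rintegral.
pose g (s : R) : \bar R := (s `^ (a - 1) * expR (- s))%:E.
have g0 s : (0 <= g s)%E by rewrite lee_fin mulr_ge0 ?powR_ge0 ?expR_ge0.
have mg (D : set R) : measurable_fun D g.
  apply/measurable_EFinP; apply: measurable_funM.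
    by apply: measurable_funTS; exact: measurable_powR.
  by apply: measurableT_comp => //; exact: measurableT_comp.
apply: fine_gt0; apply/andP; split.
  pose c : R := Num.min (1 `^ (a - 1)) (2 `^ (a - 1)) * expR (- 2).
  pose D12 : set R := `[1, 2]%classic.
  have mD12 : measurable D12 by exact: measurable_itv.
  have cD : (0 < \int[lebesgue_measure]_(s in D12) c%:E)%E.
    rewrite integral_cst//= /D12 lebesgue_measure_itv/= lte_fin ltr1n/= -EFinM lte_fin.
    rewrite !mulr_gt0 ?expR_gt0// ?lt_min ?powR_gt0//.
  apply: (lt_le_trans cD).
  apply: (@le_trans _ _ (\int[lebesgue_measure]_(s in D12) g s)%E).
    apply: ge0_le_integral => //.
    - by move=> s _; rewrite lee_fin mulr_ge0 ?expR_ge0// le_min !powR_ge0.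
    - exact: mg.
    - move=> s; rewrite /D12 /= in_itv/= => s12; rewrite /g /c lee_fin.
      have m0 : 0 <= Num.min (1 `^ (a - 1)) (2 `^ (a - 1)) by rewrite le_min !powR_ge0.
      apply: ler_pM; [exact: m0|exact: expR_ge0|exact: powR_ge_min|].
      by rewrite ler_expR lerN2; case/andP: s12.
  apply: ge0_subset_integral => //; [exact: mg|].
  by move=> s; rewrite /D12/= !in_itv/= => /andP[s1 _]; rewrite andbT (lt_le_trans _ s1).
have -> : `]0, +oo[%classic = `]0, 1[ `|` `[1, +oo[ :> set R.
  by rewrite -itv_bndbnd_setU// bnd_simp.
rewrite ge0_integral_setU//; last 3 first.
- exact: mg.
- by move=> s _; exact: g0.
- apply/disj_setPS => s /=; rewrite !in_itv/= andbT => -[/andP[_ s1] s2].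
  by move: (lt_le_trans s1 s2); rewrite ltxx.
apply: lte_add_pinfty.
  (* Near 0 the exponential is at most 1, and the remaining power is the singularity already
     treated, centred at 0. *)
  apply: le_lt_trans
    (@integral_abs_powR_lty R a 0 1 `]0, 1[ a0 ltr01 _ _) => //; last first.
    by move=> s /=; rewrite in_itv/= subr0 => /andP[s0 s1]; rewrite gtr0_norm ?s0.
  apply: ge0_le_integral => //.
  - by move=> s _; exact: g0.
  - exact: mg.
  - apply/measurable_EFinP; apply: (measurableT_comp (measurable_powR _)).
    by apply: measurableT_comp => //; exact: measurable_funB.
  - move=> s /=; rewrite in_itv/= subr0 => /andP[s0 s1].
    rewrite lee_fin gtr0_norm// ler_piMr ?powR_ge0// -expR0 ler_expR.
    by rewrite oppr_le0 ltW.
(* Half of the exponential decay absorbs the power; the other half is, up to the factor 2 in [C],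
   the exponential density of rate 1/2. *)
pose C := (2 * a) `^ a * 2.
have C0 : 0 <= C by rewrite mulr_ge0 ?powR_ge0.
have bnd (s : R) : 1 <= s ->
    s `^ (a - 1) * expR (- s) <= C * (2^-1 * expR (- 2^-1 * s)).
  move=> s1; apply: (@le_trans _ _ (s `^ a * expR (- s))).
    by rewrite ler_wpM2r ?expR_ge0// ler_powR// gerBl.
  apply: (@le_trans _ _ ((2 * a) `^ a * expR (s / 2) * expR (- s))).
    by rewrite ler_wpM2r ?expR_ge0// powR_le_expR// (le_trans ler01).
  rewrite -mulrA -expRD (_ : s / 2 - s = - 2^-1 * s); last by field.
  by rewrite /C -mulrA mulVKf.
have half0 : 0 < 2^-1 :> R by rewrite invr_gt0.
pose D1 : set R := `[1, +oo[%classic.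
have mD1 : measurable D1 by exact: measurable_itv.
rewrite -/D1.
have mexp (D : set R) :
    measurable_fun D (fun s => (exponential_pdf 2^-1 s)%:E : \bar R).
  by apply/measurable_EFinP; apply: measurable_funTS; exact: measurable_exponential_pdf.
apply: (@le_lt_trans _ _
    (\int[lebesgue_measure]_(s in D1) (C%:E * (exponential_pdf 2^-1 s)%:E))%E).
  apply: ge0_le_integral => //.
  - by move=> s _; exact: g0.
  - exact: mg.
  - by apply: measurable_funeM; exact: mexp.
  - move=> s; rewrite /D1 /= in_itv/= andbT => s1.
    by rewrite -EFinM lee_fin exponential_pdfE ?bnd// (le_trans ler01).
have p0 s : (0 <= (exponential_pdf 2^-1 s)%:E)%E.
  by rewrite lee_fin exponential_pdf_ge0// ltW.
rewrite ge0_integralZl//; last exact: mexp.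
apply: lte_mul_pinfty => //.
apply: (@le_lt_trans _ _ (\int[lebesgue_measure]_s (exponential_pdf 2^-1 s)%:E)%E).
  by apply: ge0_subset_integral => //; exact: mexp.
by rewrite integral_exponential_pdf// ltry.
Qed.

(** * The Gaussian integral *)

(** The integrand is the normal density of mean [x] and variance [2 * s], multiplied by the inverse
    of its peak. *)
Lemma integral_gauss1 (R : realType) (x s : R) : 0 < s ->
  (\int[lebesgue_measure]_y (expR (- ((x - y) ^+ 2 / (4 * s))))%:E =
   (Num.sqrt (4 * pi * s))%:E)%E.
Proof.
move=> s0; pose sd := Num.sqrt (2 * s).
have sd2 : sd ^+ 2 = 2 * s by rewrite sqr_sqrtr// mulr_ge0// ltW.
have sd0 : sd != 0 by rewrite gt_eqF// sqrtr_gt0 mulr_gt0.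
have p4 : Num.sqrt (4 * pi * s) != 0.
  by rewrite gt_eqF// sqrtr_gt0 !mulr_gt0 ?pi_gt0.
have mpdf : measurable_fun [set: R] (fun y => (normal_pdf x sd y)%:E : \bar R).
  by apply/measurable_EFinP; exact: measurable_normal_pdf.
transitivity (\int[lebesgue_measure]_y
    ((Num.sqrt (4 * pi * s))%:E * (normal_pdf x sd y)%:E))%E.
  apply: eq_integral => y _; rewrite -EFinM normal_pdfE// /normal_peak /normal_fun sd2.
  rewrite (_ : 2 * s * pi *+ 2 = 4 * pi * s); last by ring.
  rewrite mulVKf//; congr (expR _)%:E; field.
  by rewrite gt_eqF.
rewrite ge0_integralZl//; last 1 first.
  by move=> y _; rewrite lee_fin normal_pdf_ge0.
by rewrite integral_normal_pdf mule1.
Qed.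

Lemma measurable_sqnorm (R : realType) (n : nat) :
  measurable_fun [set: Rn R n] (@sqnorm R n).
Proof.
apply: (@measurable_sum _ _ R _ _ _ (fun i x => (tnth x i : R) ^+ 2)) => i.
by apply: measurable_funX; exact: measurable_tnth.
Qed.

Lemma measurable_sqnorm_subRn (R : realType) (n : nat) (x : Rn R n) :
  measurable_fun [set: Rn R n] (fun y => sqnorm (subRn x y)).
Proof.
rewrite (_ : (fun y => _) =
    (fun y : Rn R n => \sum_(i < n) (tnth x i - tnth y i : R) ^+ 2)).
  2: by apply/funext => y; apply: eq_bigr => i _; rewrite tnth_mktuple.
apply: (@measurable_sum _ _ R _ _ _
  (fun i (y : Rn R n) => (tnth x i - tnth y i : R) ^+ 2)) => i.
by apply: measurable_funX; apply: measurable_funB => //; exact: measurable_tnth.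
Qed.

(** Induction along the recursive construction of [lebesgue_Rn]: the squared norm splits off the
    first coordinate, so Tonelli factors the integral. In dimension 0 the measure is the Dirac mass
    at the empty tuple. *)
Lemma integral_gauss_Rn (R : realType) (n : nat) (x : Rn R n) (s : R) : 0 < s ->
  (\int[lebesgue_Rn R n]_y (expR (- (sqnorm (subRn x y) / (4 * s))))%:E =
   (Num.sqrt (4 * pi * s) ^+ n)%:E)%E.
Proof.
move=> s0.
have mg m (z : Rn R m) : measurable_fun [set: Rn R m]
    (fun y => (expR (- (sqnorm (subRn z y) / (4 * s))))%:E : \bar R).
  apply/measurable_EFinP; apply: measurableT_comp => //.
  apply: measurableT_comp => //; apply: measurable_funM => //.
  exact: measurable_sqnorm_subRn.
elim: n x => [x|n IH x].
  rewrite integral_dirac//=; last exact: mg.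
  by rewrite diracE mem_set// mul1e /sqnorm big_ord0 mul0r oppr0 expR0.
pose x0 : R := thead x; pose x' : Rn R n := [tuple of behead x].
rewrite [LHS](ge0_integral_pushforward (@measurable_tuple_cons R n)
  (lebesgue_measure \x lebesgue_Rn R n)%E measurableT (mg _ _))//.
rewrite preimage_setT fubini_tonelli1//=; last first.
  by apply: (measurableT_comp (mg _ _)); exact: measurable_tuple_cons.
have E (a : R) (y : Rn R n) : sqnorm (subRn x (tuple_cons (a, y))) =
    (x0 - a) ^+ 2 + sqnorm (subRn x' y).
  rewrite /sqnorm big_ord_recl; congr +%R.
    by rewrite tnth_mktuple.
  apply: eq_bigr => i _; rewrite !tnth_mktuple [in LHS](tuple_eta x) !tnthS.
  by congr (_ ^+ 2); congr (tnth _ _ - tnth _ _); apply: val_inj.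
transitivity (\int[lebesgue_measure]_a ((Num.sqrt (4 * pi * s) ^+ n)%:E *
    (expR (- ((x0 - a) ^+ 2 / (4 * s))))%:E))%E.
  apply: eq_integral => a _; rewrite /fubini_F /= -(IH x') muleC.
  rewrite -ge0_integralZl//; last exact: mg.
  by apply: eq_integral => y _; rewrite /= E mulrDl opprD expRD EFinM.
rewrite ge0_integralZl//; last 1 first.
  apply/measurable_EFinP; apply: measurableT_comp => //.
  apply: measurableT_comp => //; apply: measurable_funM => //.
  by apply: measurable_funX; exact: measurable_funB.
by rewrite integral_gauss1// -EFinM -exprSr.
Qed.

(** * The fractional heat kernel *)

Section kernel.
Context (R : realType) (n : nat).
Implicit Types (a s t : R) (x y : Rn R n) (z w : spacetime R n).

(** Brings the normalisation of [Phi] to the form produced by [integral_gauss_Rn]. *)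
Lemma powR_half_nat a : 0 <= a -> a `^ (n%:R / 2) = Num.sqrt a ^+ n.
Proof. by move=> a0; rewrite mulrC powRrM powR12_sqrt// powR_mulrn ?sqrtr_ge0. Qed.

Lemma Phi_ge0 a x s : 0 < a -> 0 <= Phi a x s.
Proof.
move=> a0; rewrite /Phi !mulr_ge0 ?powR_ge0 ?invr_ge0 ?expR_ge0//.
  by rewrite ltW ?Gamma_gt0.
exact: powR_ge0.
Qed.

Lemma Phi_gt0E a x s : 0 < s -> Phi a x s =
  s `^ (a - 1) / Gamma a * (Num.sqrt (4 * pi * s) ^+ n)^-1 *
  expR (- (sqnorm x / (4 * s))).
Proof.
move=> s0; rewrite /Phi indicE mem_set ?mulr1 /= ?in_itv/= ?s0//.
by rewrite powR_half_nat// !mulr_ge0 ?pi_ge0// ltW.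
Qed.

Lemma measurable_Phi a z : measurable_fun [set: spacetime R n]
  (fun w => Phi a (subRn z.1 w.1) (z.2 - w.2 : R)).
Proof.
have ms : measurable_fun [set: spacetime R n] (fun w => (z.2 - w.2 : R)).
  by apply: measurable_funB => //; exact: measurable_snd.
have mp (b : R) : measurable_fun [set: spacetime R n] (fun w => (z.2 - w.2 : R) `^ b).
  exact: (measurableT_comp (measurable_powR _) ms).
have mq : measurable_fun [set: spacetime R n] (fun w => sqnorm (subRn z.1 w.1)).
  exact: (measurableT_comp (measurable_sqnorm_subRn z.1) measurable_fst).
(* For negative s the power s^(-1) is not the inverse of s, but then the
   indicator vanishes. *)
rewrite (_ : (fun w => _) = (fun w : spacetime R n =>
    (z.2 - w.2 : R) `^ (a - 1) / Gamma a *
    (4 * pi * (z.2 - w.2 : R)) `^ (- (n%:R / 2)) *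
    expR (- (sqnorm (subRn z.1 w.1) * (4^-1 * (z.2 - w.2 : R) `^ (- 1)))) *
    \1_`]0, +oo[ (z.2 - w.2 : R))).
  2: {
    apply/funext => w; rewrite /Phi powRN indicE.
    have [s0|s0] := ltP 0 (z.2 - w.2 : R).
      by rewrite powR_inv1 ?ltW// invfM.
    by rewrite memNset ?mulr0//= in_itv/= andbT; apply/negP; rewrite -leNgt. }
apply: measurable_funM; last first.
  by apply: (measurableT_comp _ ms); apply: measurable_indic; exact: measurable_itv.
apply: measurable_funM.
  apply: measurable_funM; first exact: measurable_funM.
  apply: (measurableT_comp (measurable_powR _)).
  exact: measurable_funM.
apply: measurableT_comp => //; apply: measurableT_comp => //.
apply: measurable_funM.
  exact: mq.
exact: measurable_funM.
Qed.

(** The Gaussian factor is a probability density in [y], so only the time factor survives. *)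
Lemma integral_Phi a x s : 0 < a -> 0 < s ->
  (\int[lebesgue_Rn R n]_y (Phi a (subRn x y) s)%:E =
   (s `^ (a - 1) / Gamma a)%:E)%E.
Proof.
move=> a0 s0; set c := s `^ (a - 1) / Gamma a.
pose P := Num.sqrt (4 * pi * s) ^+ n.
have P0 : 0 < P by rewrite exprn_gt0// sqrtr_gt0 !mulr_gt0// pi_gt0.
transitivity (\int[lebesgue_Rn R n]_y ((c / P)%:E *
    (expR (- (sqnorm (subRn x y) / (4 * s))))%:E))%E.
  by apply: eq_integral => y _; rewrite Phi_gt0E.
rewrite ge0_integralZl//; last 2 first.
- apply/measurable_EFinP; apply: measurableT_comp => //.
  apply: measurableT_comp => //; apply: measurable_funM => //.
  exact: measurable_sqnorm_subRn.
- by rewrite lee_fin !divr_ge0 ?powR_ge0// ?ltW ?Gamma_gt0.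
by rewrite integral_gauss_Rn// -EFinM divfK// gt_eqF.
Qed.

Definition paraboloid : set (spacetime R n) := [set z | sqnorm z.1 < z.2].

Lemma measurable_paraboloid : measurable paraboloid.
Proof.
have m : measurable_fun [set: spacetime R n] (fun w => (w.2 : R) - sqnorm w.1).
  apply: measurable_funB; first exact: measurable_snd.
  exact: (measurableT_comp (@measurable_sqnorm R n) measurable_fst).
have := m measurableT _ (measurable_itv `]0, +oo[); rewrite setTI.
by congr measurable; apply/seteqP; split => w /=; rewrite in_itv/= andbT subr_gt0.
Qed.

Lemma sqnorm_ge0 x : 0 <= sqnorm x.
Proof. by apply: sumr_ge0 => i _; exact: sqr_ge0. Qed.

Lemma paraboloid_gt0 z : paraboloid z -> 0 < z.2 :> R.
Proof. exact: le_lt_trans (sqnorm_ge0 _). Qed.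

Definition parab_pow A g z : R := A * (z.2 : R) `^ g * \1_paraboloid z.

Lemma parab_pow_in A g z : paraboloid z -> parab_pow A g z = A * (z.2 : R) `^ g.
Proof. by move=> pz; rewrite /parab_pow indicE mem_set// mulr1. Qed.

Lemma parab_pow_out A g z : ~ paraboloid z -> parab_pow A g z = 0.
Proof. by move=> pz; rewrite /parab_pow indicE memNset// mulr0. Qed.

Lemma parab_pow_ge0 A g z : 0 <= A -> 0 <= parab_pow A g z.
Proof. by move=> A0; rewrite /parab_pow !mulr_ge0 ?powR_ge0. Qed.

Lemma parab_pow_le A g z t : 0 <= A -> 0 <= g -> z.2 <= t :> R ->
  parab_pow A g z <= A * t `^ g.
Proof.
move=> A0 g0 zt; have [pz|pz] := pselect (paraboloid z); last first.
  by rewrite parab_pow_out// mulr_ge0 ?powR_ge0.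
rewrite parab_pow_in// ler_wpM2l// ge0_ler_powR ?nnegrE//.
  by rewrite ltW// paraboloid_gt0.
by rewrite (le_trans _ zt)// ltW// paraboloid_gt0.
Qed.

Lemma measurable_parab_pow A g :
  measurable_fun [set: spacetime R n] (parab_pow A g).
Proof.
apply: measurable_funM.
  apply: measurable_funM => //.
  exact: (measurableT_comp (measurable_powR _) measurable_snd).
by apply: measurable_indic; exact: measurable_paraboloid.
Qed.
End kernel.

(** * Potentials of powers of time on the paraboloid *)

Section potential.
Context (R : realType) (n : nat).
Implicit Types (a g A t : R) (x y : Rn R n) (z w : spacetime R n).

Lemma measurable_J_integrand a A g z (D : set (spacetime R n)) :
  measurable_fun D (fun w => (Phi a (subRn z.1 w.1) (z.2 - w.2) * parab_pow A g w)%:E).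
Proof.
apply/measurable_EFinP; apply: measurable_funTS; apply: measurable_funM.
  exact: measurable_Phi.
exact: measurable_parab_pow.
Qed.

Lemma measurable_past t : measurable [set w : spacetime R n | (w.2 : R) < t].
Proof.
have := @measurable_snd _ _ (Rn R n) (measurableTypeR R) measurableT _
  (measurable_itv `]-oo, t[); rewrite setTI.
by congr measurable; apply/seteqP; split => w /=; rewrite in_itv.
Qed.

Lemma J_ge0 a A g z : 0 < a -> 0 <= A -> (0 <= J a (parab_pow A g) z)%E.
Proof.
move=> a0 A0; apply: integral_ge0 => w _.
by rewrite lee_fin mulr_ge0 ?Phi_ge0 ?parab_pow_ge0.
Qed.

(** The paraboloid lies in positive times, so the past of a negative time misses the support of the
    data. *)
Lemma J_lt0 a A g x t : t < 0 -> J a (parab_pow A g) (x, t) = 0%E.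
Proof.
move=> t0; apply: integral0_eq => w /= wt.
rewrite parab_pow_out ?mulr0// => /paraboloid_gt0 w0.
by have := lt_trans (lt_trans w0 wt) t0; rewrite ltxx.
Qed.

Lemma J_parab_pow_lty a A g z : 0 < a -> 0 <= A -> 0 <= g ->
  (J a (parab_pow A g) z < +oo)%E.
Proof.
move=> a0 A0 g0; case: z => x t; rewrite /J /=.
have [t0|t0] := ltP t 0; first by have := J_lt0 a A g x t0; rewrite /J /= => ->.
pose I : set R := `]0, t[%classic.
have mI : measurable I by exact: measurable_itv.
(* Up to time [t] the data are at most [M] and live in times of [I]; the majorant [F] spreads the
   value [M] over the whole slab, which makes the integral over space explicit. *)
pose M := A * t `^ g.
have M0 : 0 <= M by rewrite mulr_ge0 ?powR_ge0.
pose F (w : spacetime R n) : \bar R :=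
  (M * \1_I (w.2 : R) * Phi a (subRn x w.1) (t - w.2))%:E.
have mF D : measurable_fun D F.
  apply: measurable_funTS; apply/measurable_EFinP; apply: measurable_funM.
    apply: measurable_funM => //.
    apply: (measurableT_comp _ measurable_snd); exact: measurable_indic.
  exact: (measurable_Phi a (x, t)).
have F0 w : (0 <= F w)%E.
  by rewrite lee_fin; apply: mulr_ge0; [exact: mulr_ge0|exact: Phi_ge0].
suff FI : (\int[@lebesgue_spacetime R n]_w F w < +oo)%E.
  apply: le_lt_trans FI; set P := (X in integral _ X _).
  have mP : measurable P by exact: measurable_past.
  apply: (@le_trans _ _ (\int[@lebesgue_spacetime R n]_(w in P) F w)%E).
    apply: ge0_le_integral => //.
    - by move=> w _; rewrite lee_fin mulr_ge0 ?Phi_ge0 ?parab_pow_ge0.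
    - exact: (measurable_J_integrand a A g (x, t)).
    - move=> w /= wt; rewrite lee_fin mulrC ler_wpM2r ?Phi_ge0//.
      have [pw|pw] := pselect (paraboloid w); last first.
        by rewrite parab_pow_out// mulr_ge0.
      rewrite indicE mem_set ?mulr1 ?parab_pow_le//; first exact: ltW.
      by rewrite /I /= in_itv/= wt paraboloid_gt0.
  by apply: ge0_subset_integral => //.
(* Tonelli with space integrated first: [integral_Phi] leaves a constant multiple of the power of
   [t - s]. *)
rewrite /lebesgue_spacetime (fubini_tonelli2 F)//.
rewrite (_ : (\int[_]_y _)%E = (\int[lebesgue_measure]_(s in I)
    ((M / Gamma a)%:E * (`|s - t| `^ (a - 1))%:E))%E); last first.
  rewrite [RHS]integral_mkcond; apply: eq_integral => s _.
  rewrite /fubini_G /F /= patchE; case: ifPn => [|sI].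
    move=> /[dup] sI /set_mem; rewrite /I /= in_itv/= => /andP[s0 st].
    transitivity (\int[lebesgue_Rn R n]_y (M%:E * (Phi a (subRn x y) (t - s))%:E))%E.
      by apply: eq_integral => y _; rewrite indicE sI mulr1 EFinM.
    rewrite ge0_integralZl//; last 2 first.
    - apply: (measurable_fun_pair1 s (f := fun w : spacetime R n =>
        (Phi a (subRn x w.1) (t - w.2))%:E)).
      by apply/measurable_EFinP; exact: (measurable_Phi a (x, t)).
    - by move=> y _; rewrite lee_fin Phi_ge0.
    rewrite integral_Phi// ?subr_gt0// -!EFinM distrC gtr0_norm ?subr_gt0//.
    by rewrite mulrA mulrAC.
  by apply: integral0_eq => y _; rewrite indicE (negbTE sI) mulr0 mul0r.
have mp (D : set R) : measurable_fun D (fun s => (`|s - t| `^ (a - 1))%:E : \bar R).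
  apply: measurable_funTS.
  apply/measurable_EFinP; apply: (measurableT_comp (measurable_powR _)).
  by apply: measurableT_comp => //; exact: measurable_funB.
rewrite ge0_integralZl//; last 2 first.
- exact: mp.
- by rewrite lee_fin divr_ge0// ltW// Gamma_gt0.
apply: lte_mul_pinfty => //.
  by rewrite lee_fin divr_ge0// ltW// Gamma_gt0.
(* At [t = 0] the slab is empty; otherwise [t] itself serves as the radius. *)
move: t0; rewrite le_eqVlt => /predU1P[t0|t0].
  by rewrite /I -t0 set_itv_ge ?integral_set0// bnd_simp ltxx.
apply: (integral_abs_powR_lty a0 t0 mI) => s /=.
rewrite /I/= in_itv/= => /andP[s0 st].
by rewrite distrC gtr0_norm ?subr_gt0// st/= gtrDl oppr_lt0.
Qed.
End potential.

(** * Lower bound for the potentials on the paraboloid *)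

Section lower_bound.
Context (R : realType) (n : nat).
Implicit Types (a g A t : R) (x y : Rn R n) (z w : spacetime R n).

Lemma measurable_box (I : set R) : measurable I ->
  measurable [set x : Rn R n | forall i, I (tnth x i)].
Proof.
move=> mI; rewrite (_ : mkset _ =
    \bigcap_(i in [set: 'I_n]) ((@tnth n _ ^~ i) @^-1` I)).
  apply: fin_bigcap_measurable => // i _.
  by rewrite -[X in measurable X]setTI; exact: measurable_tnth.
by apply/seteqP; split => x /= h i; [move=> _|]; apply: h.
Qed.

(** Coordinatewise, the difference of the two sides is the square of the sum. *)
Lemma sqnorm_subRn_le x y : sqnorm (subRn x y) <= 2 * sqnorm x + 2 * sqnorm y.
Proof.
rewrite /sqnorm !mulr_sumr -big_split/=; apply: ler_sum => i _.
rewrite tnth_mktuple; set b : R := tnth x i; set c : R := tnth y i.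
by have := sqr_ge0 (b + c); nra.
Qed.

Lemma box_sqnorm_le (r : R) y : (forall i, `[- r, r]%classic (tnth y i : R)) ->
  sqnorm y <= n%:R * r ^+ 2.
Proof.
move=> yr; rewrite mulr_natl -[X in _ *+ X]card_ord -sumr_const.
apply: ler_sum => i _; have := yr i; rewrite /= in_itv/= => /andP[r1 r2].
set c : R := tnth y i in r1 r2 *; nra.
Qed.

(* The box used below, [|y_i| <= sqrt (t / 8n)] and [t/4 <= s <= t/2], lies in
   the paraboloid, has volume of order [t^(n/2 + 1)], and [|x - y|^2 / 4(t - s)]
   is bounded on it. *)
Lemma J_parab_pow_ge a g : (0 < n)%N -> 0 < a -> 0 <= g ->
  exists2 c : R, 0 < c & forall A x t, 0 <= A -> sqnorm x < t ->
    ((c * A * t `^ (a + g))%:E <= J a (parab_pow A g) (x, t))%E.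
Proof.
move=> n0 a0 g0.
have nR0 : 0 < n%:R :> R by rewrite ltr0n.
(* On the box (t - s) / t lies in [1/2, 3/4], hence (t - s)^(a - 1) is at least [m] t^(a - 1). *)
pose m : R := Num.min ((2^-1) `^ (a - 1)) ((3 / 4) `^ (a - 1)).
have m0 : 0 < m by rewrite lt_min !powR_gt0// divr_gt0.
(* [k] is the ratio of the side [2 * r] of the box to the Gaussian normalisation [P], both of order
   sqrt t; it does not depend on [t]. *)
pose k : R := Num.sqrt (8 * pi * n%:R)^-1.
have k0 : 0 < k by rewrite sqrtr_gt0 invr_gt0 !mulr_gt0 ?pi_gt0.
exists (m / Gamma a * expR (- 2) * (4^-1) `^ g * k ^+ n / 4).
  by rewrite !(mulr_gt0, divr_gt0) ?invr_gt0 ?expR_gt0 ?powR_gt0 ?exprn_gt0 ?Gamma_gt0.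
move=> A x t A0 xt; have t0 : 0 < t := le_lt_trans (sqnorm_ge0 x) xt.
pose r := Num.sqrt (t / (8 * n%:R)).
have r2 : n%:R * r ^+ 2 = t / 8.
  by rewrite sqr_sqrtr; [field; rewrite gt_eqF|rewrite ltW// divr_gt0// mulr_gt0].
have r0 : 0 < r by rewrite sqrtr_gt0 divr_gt0// mulr_gt0.
pose Ir : set R := `[- r, r]%classic.
pose It : set R := `[t / 4, t / 2]%classic.
have mIr : measurable Ir by exact: measurable_itv.
have mIt : measurable It by exact: measurable_itv.
pose Q : set (Rn R n) := [set y | forall i, Ir (tnth y i)].
have mQ : measurable Q by exact: measurable_box.
pose B : set (spacetime R n) := Q `*` It.
have mB : measurable B by exact: measurableX.
pose P := Num.sqrt (4 * pi * t).
have P0 : 0 < P by rewrite sqrtr_gt0 !mulr_gt0// pi_gt0.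
have mt0 : 0 <= m * t `^ (a - 1) / Gamma a.
  by rewrite divr_ge0 ?mulr_ge0 ?powR_ge0 ?(ltW m0)// ltW// Gamma_gt0.
have mtP0 : 0 <= m * t `^ (a - 1) / Gamma a * (P ^+ n)^-1.
  by rewrite (mulr_ge0 mt0)// invr_ge0 exprn_ge0// ltW.
pose C := m * t `^ (a - 1) / Gamma a * (P ^+ n)^-1 * expR (- 2) * (A * (t / 4) `^ g).
have C0 : 0 <= C.
  by rewrite mulr_ge0 ?(mulr_ge0 mtP0) ?expR_ge0// mulr_ge0// powR_ge0.
have muB : @lebesgue_spacetime R n B = ((2 * r) ^+ n * (t / 4))%:E.
  transitivity (lebesgue_Rn R n Q * lebesgue_measure It)%E.
    exact: product_measure1E.
  have itE (u v : R) : u < v -> lebesgue_measure (`[u, v]%classic : set R) = (v - u)%:E.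
    by move=> uv; rewrite lebesgue_measure_itv/= lte_fin uv.
  rewrite (lebesgue_Rn_box (A := fun _ : 'I_n => Ir))//.
  rewrite /Ir /It !itE; last 2 first.
    by lra.
    by lra.
  rewrite prodEFin -EFinM prodr_const card_ord; congr (_%:E); congr (_ ^+ _ * _); lra.
have lowB w : B w -> C <= Phi a (subRn x w.1) (t - w.2 : R) * parab_pow A g w.
  case: w => y s [/= yQ]; rewrite /It /= in_itv/= => /andP[s1 s2].
  have ts0 : 0 < t - s by lra.
  have yr := box_sqnorm_le yQ; rewrite r2 in yr.
  (* Here |y|^2 <= t/8 < t/4 <= s. *)
  have pw : paraboloid (y, s) by rewrite /paraboloid /=; lra.
  rewrite parab_pow_in// Phi_gt0E//=.
  apply: ler_pM.
  - by rewrite (mulr_ge0 mtP0)// expR_ge0.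
  - by rewrite mulr_ge0 ?powR_ge0.
  - apply: ler_pM; rewrite ?expR_ge0//.
    + apply: ler_pM; rewrite ?invr_ge0 ?exprn_ge0 ?(ltW P0)//.
      * rewrite ler_wpM2r ?invr_ge0 ?(ltW (Gamma_gt0 a0))//.
        rewrite [X in _ <= X `^ _](_ : t - s = ((t - s) / t) * t); last first.
          by rewrite divfK// gt_eqF.
        rewrite powRM ?divr_ge0 ?(ltW t0) ?(ltW ts0)// ler_wpM2r ?powR_ge0//.
        apply: powR_ge_min => //; rewrite ler_pdivlMr// ler_pdivrMr//.
        by apply/andP; split; lra.
      * rewrite lef_pV2 ?posrE ?exprn_gt0//; last first.
          by rewrite sqrtr_gt0 !mulr_gt0// pi_gt0.
        rewrite lerXn2r ?nnegrE ?sqrtr_ge0//.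
        apply: ler_wsqrtr; rewrite ler_wpM2l ?mulr_ge0 ?pi_ge0//.
        by lra.
    (* |x - y|^2 is at most 2t + t/4, while 4(t - s) is at least 2t; the quotient is below 2. *)
    + rewrite ler_expR lerN2 ler_pdivrMr ?mulr_gt0//.
      by apply: (le_trans (sqnorm_subRn_le _ _)); lra.
  - rewrite ler_wpM2l// ge0_ler_powR// nnegrE; lra.
set LB := (X in X%:E).
have -> : LB%:E = (\int[@lebesgue_spacetime R n]_(w in B) C%:E)%E.
  transitivity (C%:E * @lebesgue_spacetime R n B)%E; last by rewrite integral_cst.
  rewrite muB -EFinM /LB; congr (_%:E).
  have rP : 2 * r = k * P.
    rewrite /k /P -sqrtrM ?invr_ge0 ?mulr_ge0 ?pi_ge0//.
    rewrite (_ : _ * (4 * pi * t) = 2 ^+ 2 * (t / (8 * n%:R))); last first.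
      by move: (pi_gt0 R); move: (pi : R) => p0 p0_gt0; field; rewrite !gt_eqF.
    by rewrite sqrtrM ?sqrtr_sqr ?ger0_norm.
  (* The factor [P ^+ n] cancels, and t^(a - 1), the length t/4 of the time interval and (t/4)^g
     combine to t^(a + g). *)
  rewrite rP exprMn /C (_ : a + g = (a - 1) + 1 + g); last by ring.
  rewrite !powRD ?(gt_eqF t0) ?implybT// powRr1 ?(ltW t0)//.
  rewrite [(t / 4) `^ g]powRM ?(ltW t0) ?invr_ge0//.
  field.
  by rewrite !gt_eqF ?Gamma_gt0 ?exprn_gt0.
have mJ := @measurable_J_integrand R n a A g (x, t).
rewrite /J /=; set P' := (X in (_ <= integral _ X _)%E).
have mP' : measurable P' by exact: measurable_past.
have BP : B `<=` P'.
  move=> [y s] [_ /=]; rewrite /It /= in_itv/= => /andP[s1 s2]; rewrite /P' /=.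
  by move: s2; set s' : R := s => s2; apply: (le_lt_trans s2); lra.
apply: (@le_trans _ _ (\int[@lebesgue_spacetime R n]_(w in B)
   (Phi a (subRn x w.1) (t - w.2) * parab_pow A g w)%:E)%E).
  apply: ge0_le_integral => //.
apply: ge0_subset_integral => //.
by move=> w _; rewrite lee_fin mulr_ge0 ?Phi_ge0 ?parab_pow_ge0.
Qed.
End lower_bound.

(** * Parabolic powers as data for the fractional heat operator *)

Section parabolic_powers.
Context (R : realType) (n : nat).
Implicit Types (a g A p t : R) (x y : Rn R n) (z w : spacetime R n).

(** Below any time [T] the paraboloid is bounded, and the data are bounded there by a constant;
    every power is then integrable. *)
Lemma Xspace_parab_pow A g p : 0 <= A -> 0 <= g -> 1 <= p ->
  Xspace p (@parab_pow R n A g).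
Proof.
move=> A0 g0 p1; have p0 : 0 < p := lt_le_trans ltr01 p1.
split; first exact: measurable_parab_pow.
(* [S >= 1] gives S <= S^2, so that y_i^2 <= |y|^2 < s <= S yields |y_i| <= S. *)
move=> T; pose S : R := `|T| + 1.
have S1 : 1 <= S by rewrite lerDr.
pose M := A * S `^ g.
have M0 : 0 <= M by rewrite mulr_ge0 ?powR_ge0.
pose Ir : set R := `[- S, S]%classic.
pose It : set R := `[0, S]%classic.
have mIr : measurable Ir by exact: measurable_itv.
have mIt : measurable It by exact: measurable_itv.
pose Q : set (Rn R n) := [set y | forall i, Ir (tnth y i)].
have mQ : measurable Q by exact: measurable_box.
pose B : set (spacetime R n) := Q `*` It.
have mB : measurable B by exact: measurableX.
have muB : (@lebesgue_spacetime R n B < +oo)%E.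
  have -> : @lebesgue_spacetime R n B = (lebesgue_Rn R n Q * lebesgue_measure It)%E.
    exact: product_measure1E.
  have itE (u v : R) : u < v -> lebesgue_measure (`[u, v]%classic : set R) = (v - u)%:E.
    by move=> uv; rewrite lebesgue_measure_itv/= lte_fin uv.
  rewrite (lebesgue_Rn_box (A := fun _ : 'I_n => Ir))// /Ir /It !itE; last 2 first.
    by lra.
    by lra.
  by rewrite prodEFin -EFinM ltry.
set h := (X in finite_norm _ _ X).
have mh : measurable_fun [set: spacetime R n] h.
  apply: measurable_funM; first exact: measurable_parab_pow.
  by apply: measurable_indic; exact: measurable_past.
have hB w : `|h w| <= M * \1_B w.
  rewrite /h /=; have [pw|pw] := pselect (paraboloid w); last first.
    by rewrite parab_pow_out// mul0r normr0 mulr_ge0.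
  rewrite [X in _ * X]indicE; have [wT|wT] := ltP (w.2 : R) T; last first.
    rewrite memNset ?mulr0 ?normr0 ?(mulr_ge0 M0)//=.
    by move=> /(le_lt_trans wT); rewrite ltxx.
  rewrite mem_set// mulr1 ger0_norm ?parab_pow_ge0//.
  have wS : (w.2 : R) <= S.
    by rewrite (le_trans (ltW wT))// (le_trans (ler_norm T))// lerDl.
  have Bw : B w.
    split; last by rewrite /It /= in_itv/= wS ltW// paraboloid_gt0.
    move=> i; rewrite /Ir /= in_itv/= -ler_norml.
    rewrite -(@ler_pXn2r _ 2%N)// ?nnegrE//; last first.
      by rewrite (le_trans ler01).
    rewrite real_normK ?num_real//.
    apply: (@le_trans _ _ (sqnorm w.1)).
      rewrite /sqnorm (bigD1 i)//= lerDl; apply: sumr_ge0 => j _; exact: sqr_ge0.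
    rewrite (le_trans (ltW pw))// (le_trans wS)// expr2 ler_peMl// (le_trans ler01)//.
  by rewrite indicE mem_set// mulr1 parab_pow_le.
rewrite /finite_norm unlock; apply: poweR_lty.
have mhp : measurable_fun [set: spacetime R n] (fun w => (`|h w| `^ p)%:E : \bar R).
  apply/measurable_EFinP; apply: (measurableT_comp (measurable_powR _)).
  exact: measurableT_comp.
apply: (@le_lt_trans _ _ (\int[@lebesgue_spacetime R n]_w ((M `^ p) * \1_B w)%:E)%E).
  apply: ge0_le_integral => //.
  - by move=> w _; exact: poweR_ge0.
  - by apply/measurable_EFinP; apply: measurable_funM => //; exact: measurable_indic.
  - move=> w _ /=; rewrite lee_fin.
    have [Bw|Bw] := pselect (B w).
      have := hB w; rewrite indicE mem_set// !mulr1 => hw.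
      by rewrite ge0_ler_powR ?nnegrE// ltW.
    have := hB w; rewrite indicE memNset// !mulr0 normr_le0 => /eqP ->.
    (* The power of 0 vanishes because [p] is nonzero; with exponent 0 it would be 1. *)
    by rewrite normr0 powR0// gt_eqF.
have -> : (\int[@lebesgue_spacetime R n]_w ((M `^ p) * \1_B w)%:E =
    (M `^ p)%:E * @lebesgue_spacetime R n B)%E.
  under eq_integral do rewrite EFinM.
  rewrite ge0_integralZl//; last 2 first.
  - by apply/measurable_EFinP; exact: measurable_indic.
  - by rewrite lee_fin powR_ge0.
  by rewrite integral_indic// setIT.
by apply: lte_mul_pinfty => //; rewrite lee_fin powR_ge0.
Qed.

(** Elements of [Yspace] are real-valued while [J] takes extended values; by finiteness of the
    potential, [fine] loses nothing for the parameters considered. *)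
Definition J_parab a A g z : R := fine (J a (parab_pow A g) z).

Lemma J_parabE a A g z : 0 < a -> 0 <= A -> 0 <= g ->
  (J_parab a A g z)%:E = J a (parab_pow A g) z.
Proof.
by move=> a0 A0 g0; rewrite fineK// ge0_fin_numE ?J_ge0// J_parab_pow_lty.
Qed.

Lemma is_frac_heat_parab a A g p : 0 < a -> 0 <= A -> 0 <= g -> 1 <= p ->
  is_frac_heat a p (J_parab a A g) (@parab_pow R n A g).
Proof.
move=> a0 A0 g0 p1; split; first exact: Xspace_parab_pow.
by apply: aeW => z; rewrite J_parabE.
Qed.

(** Serves both differential inequalities. Off the paraboloid the datum is 0; on it, the relations
    for [A] and [g] make the datum exactly the power [r] of the lower bound for the potential. *)
Lemma parab_pow_le_powR a A B c g e r z :
  0 < a -> 0 <= B -> 0 <= c -> 0 <= e -> 0 < r ->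
  A = (c * B) `^ r -> g = (a + e) * r ->
  (forall x t, sqnorm x < t -> c * B * t `^ (a + e) <= J_parab a B e (x, t)) ->
  0 <= parab_pow A g z <= J_parab a B e z `^ r.
Proof.
move=> a0 B0 c0 e0 r0 AE gE J_ge.
have A0 : 0 <= A by rewrite AE powR_ge0.
rewrite parab_pow_ge0//=; have [pz|pz] := pselect (paraboloid z); last first.
  by rewrite parab_pow_out// powR_ge0.
rewrite parab_pow_in// AE gE powRrM -powRM ?powR_ge0 ?mulr_ge0//.
have lo := J_ge z.1 z.2 pz; rewrite -surjective_pairing in lo.
have lhs0 : 0 <= c * B * (z.2 : R) `^ (a + e) by rewrite !mulr_ge0 ?powR_ge0.
by rewrite ge0_ler_powR ?nnegrE ?(ltW r0) ?(le_trans lhs0 lo).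
Qed.

End parabolic_powers.

(** * Choice of the constants and verification of the system *)

Theorem theorem2p4 (R : realType) (n : nat) (p q lambda sigma alpha beta : R)
    (n_ge1 : (1 <= n)%N) (p_ge1 : 1 <= p) (q_ge1 : 1 <= q)
    (lambda_gt0 : 0 < lambda) (sigma_gt0 : 0 < sigma)
    (alpha_gt0 : 0 < alpha) (beta_gt0 : 0 < beta)
    (alpha_p : (1 < p /\ 0 < alpha < (n%:R + 2) / (2 * p)) \/
               (p = 1 /\ 0 < alpha <= (n%:R + 2) / (2 * p)))
    (beta_q : (1 < q /\ 0 < beta < (n%:R + 2) / (2 * q)) \/
              (q = 1 /\ 0 < beta <= (n%:R + 2) / (2 * q)))
    (sigma_lt : sigma < 1 / lambda) :
  let gamma1 := (beta + alpha * sigma) * lambda / (1 - lambda * sigma) in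
  let gamma2 := (alpha + beta * lambda) * sigma / (1 - lambda * sigma) in
  exists N : R, 0 < N /\
  exists u v : spacetime R n -> R, Yspace alpha p u /\ Yspace beta q v /\
    (exists Lu Lv : spacetime R n -> R,
      is_frac_heat alpha p u Lu /\ is_frac_heat beta q v Lv /\
      (forall z, 0 <= Lu z <= v z `^ lambda) /\
      (forall z, 0 <= Lv z <= u z `^ sigma)) /\
    (forall (x : Rn R n) (t : R), t < 0 -> u (x, t) = 0 /\ v (x, t) = 0) /\
    (forall (x : Rn R n) (t : R), sqnorm x < t ->
      N * t `^ (gamma2 / sigma) <= u (x, t) /\
      N * t `^ (gamma1 / lambda) <= v (x, t)).
Proof.
move=> gamma1 gamma2.
have D0 : 0 < 1 - lambda * sigma.
  by move: sigma_lt; rewrite ltr_pdivlMr// mulrC subr_gt0.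
have g1 : 0 <= gamma1 by rewrite ltW// divr_gt0// mulr_gt0// addr_gt0// mulr_gt0.
have g2 : 0 <= gamma2 by rewrite ltW// divr_gt0// mulr_gt0// addr_gt0// mulr_gt0.
have l0 := lt0r_neq0 lambda_gt0; have s0 := lt0r_neq0 sigma_gt0.
have d0 := lt0r_neq0 D0.
have e2 : gamma2 / sigma = alpha + gamma1 by rewrite /gamma1 /gamma2; field; rewrite d0.
have e1 : gamma1 / lambda = beta + gamma2 by rewrite /gamma1 /gamma2; field; rewrite d0.
have [c1 c1_gt0 J1] := @J_parab_pow_ge R n alpha gamma1 n_ge1 alpha_gt0 g1.
have [c2 c2_gt0 J2] := @J_parab_pow_ge R n beta gamma2 n_ge1 beta_gt0 g2.
(* One constant for both lower bounds lets [A] and [B] be sought as powers of [c], which turns the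
   system for them into linear equations for the exponents. *)
pose c := Num.min c1 c2.
have c0 : 0 < c by rewrite lt_min c1_gt0.
(* b solves the exponent equation b = (1 + (1 + b) lambda) sigma. *)
pose b := (sigma + lambda * sigma) / (1 - lambda * sigma).
pose B := c `^ b; pose A := c `^ ((1 + b) * lambda).
have A0 : 0 < A by rewrite powR_gt0.
have B0 : 0 < B by rewrite powR_gt0.
have cM (r : R) : c * c `^ r = c `^ (1 + r).
  by rewrite powRD ?powRr1 ?(ltW c0)// (gt_eqF c0) implybT.
have AE : A = (c * B) `^ lambda by rewrite cM -powRrM.
have BE : B = (c * A) `^ sigma.
  by rewrite cM -powRrM; congr (_ `^ _); rewrite /b; field.
have u_ge (x : Rn R n) t : sqnorm x < t ->
    c * A * t `^ (alpha + gamma1) <= J_parab alpha A gamma1 (x, t).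
  move=> xt; rewrite -lee_fin J_parabE ?(ltW A0)//.
  apply: le_trans (J1 _ _ _ (ltW A0) xt); rewrite lee_fin.
  by rewrite !ler_wpM2r ?powR_ge0 ?(ltW A0)// ge_min lexx.
have v_ge (x : Rn R n) t : sqnorm x < t ->
    c * B * t `^ (beta + gamma2) <= J_parab beta B gamma2 (x, t).
  move=> xt; rewrite -lee_fin J_parabE ?(ltW B0)//.
  apply: le_trans (J2 _ _ _ (ltW B0) xt); rewrite lee_fin.
  by rewrite !ler_wpM2r ?powR_ge0 ?(ltW B0)// ge_min lexx orbT.
have hu := @is_frac_heat_parab R n _ _ _ _ alpha_gt0 (ltW A0) g1 p_ge1.
have hv := @is_frac_heat_parab R n _ _ _ _ beta_gt0 (ltW B0) g2 q_ge1.
exists (c * Num.min A B); split; first by rewrite mulr_gt0// lt_min A0.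
exists (J_parab alpha A gamma1), (J_parab beta B gamma2).
split; first by exists (parab_pow A gamma1).
split; first by exists (parab_pow B gamma2).
split.
  exists (parab_pow A gamma1), (parab_pow B gamma2); split=> //; split=> //; split.
    (* The roles cross: the datum of [u] is compared with the lower bound for [v], and conversely
       below. *)
    move=> z; apply: parab_pow_le_powR AE _ v_ge => //; rewrite ?ltW//.
    by rewrite -e1 divfK.
  move=> z; apply: parab_pow_le_powR BE _ u_ge => //; rewrite ?ltW//.
  by rewrite -e2 divfK.
split=> x t xt; first by rewrite /J_parab !J_lt0.
rewrite e1 e2; split.
  apply: le_trans (u_ge _ _ xt).
  by rewrite ler_wpM2r ?powR_ge0// ler_wpM2l ?(ltW c0)// ge_min lexx.
apply: le_trans (v_ge _ _ xt).
by rewrite ler_wpM2r ?powR_ge0// ler_wpM2l ?(ltW c0)// ge_min lexx orbT.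
Qed.
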